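(* Let $G=\mathrm{SL}_n(\mathbb{C})$ and let $U\subset G$ be the subgroup of upper triangular matrices with $1$'s on the diagonal. Let $\Gamma=\{\omega_1,\ldots,\omega_{n-1}\}$ be the set of fundamental weights, with spherical functions on $G/U$ $$\phi_i(x)=\sum_{I\subset\{1,\ldots,n\},\,|I|=i}|p_{I,\{1,\ldots,i\}}(x)|^2,\qquad 1\leq i\leq n-1 .$$ Then for every real $t>0$, $t\neq1$, the image of the spherical logarithm map $\mathrm{sLog}_{\Gamma,t}=(\log_t\phi_1,\ldots,\log_t\phi_{n-1}):G/U\to\mathbb{R}^{n-1}$ is the whole space $\mathbb{R}^{n-1}$, and it agrees with the (real) valuation cone of $G/U$.
   Context: For $x\in\mathrm{SL}_n(\mathbb{C})$ and $I,J\subset\{1,\ldots,n\}$ with $|I|=|J|$, $p_{I,J}(x)$ is the minor of $x$ with rows $I$ and columns $J$; the flag minors $p_{I,\{1,\ldots,i\}}$ are right $U$-invariant and so define functions on $G/U$. $G/U$ is a quasi-affine spherical homogeneous space. $\log_t(y)=\ln y/\ln t$. The valuation cone of $G/U$ is the set of $G$-invariant discrete $\mathbb{Q}$-valued valuations of $\mathbb{C}(G/U)$, trivial on $\mathbb{C}^*$, embedded in $\mathbb{Q}^{n-1}$ by evaluating on nonzero $B$-eigenvectors (for $B$ a Borel subgroup of $G$) in the irreducible $G$-submodules of $\mathbb{C}[G/U]$ spanned by the $i\times i$ flag minors, $i=1,\ldots,n-1$; the real valuation cone is its Euclidean closure in $\mathbb{R}^{n-1}$. *)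

(* Defs.v *)
From HB Require Import structures.
From mathcomp Require Import all_boot all_order all_algebra.
From mathcomp Require Import generic_quotient fraction complex.
From mathcomp Require Import boolp classical_sets functions reals topology.
From mathcomp Require Import normedtype exp.

Set Implicit Arguments.
Unset Strict Implicit.
Unset Printing Implicit Defensive.

Import Order.TTheory GRing.Theory Num.Theory.
Import numFieldNormedType.Exports.

Local Open Scope ring_scope.
Local Open Scope quotient_scope.
Local Open Scope classical_set_scope.
Local Open Scope complex_scope.

Section SpecialLinear.
Variables (R : realType) (n : nat).
Local Notation C := R[i].

Record SL := MkSL { slval :> 'M[C]_n ; _ : \det slval == 1 }.

HB.instance Definition _ := [isSub for slval].
HB.instance Definition _ := [Choice of SL by <:].

Lemma det_SL (x : SL) : \det x = 1. Proof. by case: x => x /= /eqP. Qed.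

Fact SL1_subproof : \det (1%:M : 'M[C]_n) == 1. Proof. by rewrite det1. Qed.
Fact SLM_subproof (x y : SL) : \det (x *m y) == 1.
Proof. by rewrite det_mulmx !det_SL mulr1. Qed.
Fact SLV_subproof (x : SL) : \det (invmx x) == 1.
Proof. by rewrite det_inv det_SL invr1. Qed.

Definition SL1 := MkSL SL1_subproof.
Definition SLM x y := MkSL (SLM_subproof x y).
Definition SLV x := MkSL (SLV_subproof x).

Lemma SL_unitmx (x : SL) : slval x \in unitmx.
Proof. by rewrite unitmxE det_SL unitr1. Qed.

Fact SLMA : associative SLM.
Proof. by move=> x y z; apply/val_inj => /=; rewrite mulmxA. Qed.
Fact SL1M : left_id SL1 SLM.
Proof. by move=> x; apply/val_inj => /=; rewrite mul1mx. Qed.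
Fact SLM1 : right_id SL1 SLM.
Proof. by move=> x; apply/val_inj => /=; rewrite mulmx1. Qed.
Fact SLVM : left_inverse SL1 SLV SLM.
Proof. by move=> x; apply/val_inj => /=; rewrite mulVmx ?SL_unitmx. Qed.
Fact SLMV : right_inverse SL1 SLV SLM.
Proof. by move=> x; apply/val_inj => /=; rewrite mulmxV ?SL_unitmx. Qed.

HB.instance Definition _ := isGroup.Build SL SLMA SL1M SLM1 SLVM SLMV.

End SpecialLinear.
Arguments SL R n : clear implicits.

Section HomogeneousSpace.
Variables (R : realType) (n : nat).
Local Notation C := R[i].
Local Notation G := (SL R n).

Lemma slvalM (x y : G) : slval (x * y)%g = slval x *m slval y.
Proof. by []. Qed.

(* Membership in U. *)
Definition unipotent : {pred G} :=
  [pred u : G | [forall i : 'I_n, forall j : 'I_n,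
     (j <= i)%N ==> (slval u i j == (i == j)%:R)]].

Lemma unipotentP (u : G) :
  reflect (forall i j : 'I_n, (j <= i)%N -> slval u i j = (i == j)%:R)
          (u \in unipotent).
Proof.
apply: (iffP forallP) => [h i j ji | h i].
  by have /forallP/(_ j)/implyP/(_ ji)/eqP := h i.
by apply/forallP => j; apply/implyP => ji; apply/eqP/h.
Qed.

Lemma unipotent1 : (1%g : G) \in unipotent.
Proof. by apply/unipotentP => i j _; rewrite mxE. Qed.

Lemma unipotentM (u v : G) :
  u \in unipotent -> v \in unipotent -> (u * v)%g \in unipotent.
Proof.
move=> /unipotentP hu /unipotentP hv; apply/unipotentP => i j ji.
rewrite slvalM mxE (bigD1 i) //= hu // eqxx mul1r hv // big1 ?addr0 // => k ki.
have [kli|ilk] := leqP k i.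
  by rewrite hu // eq_sym (negPf ki) mul0r.
rewrite hv ?(leq_trans ji) 1?ltnW //; case: eqP => [kj|_]; last by rewrite mulr0.
by move: ilk; rewrite kj ltnNge ji.
Qed.

Lemma unipotentV (u : G) : u \in unipotent -> (u^-1)%g \in unipotent.
Proof.
move=> /unipotentP hu; apply/unipotentP.
suff h m (i j : 'I_n) : (n - i <= m)%N -> (j <= i)%N ->
    slval u^-1%g i j = (i == j)%:R by move=> i j; apply: h (leqnn _).
elim: m => [|m IH] in i j *; first by rewrite leqn0 subn_eq0 leqNgt ltn_ord.
move=> im ji; have : slval (u * u^-1)%g i j = (1%g : G) i j by rewrite mulgV.
rewrite slvalM mxE (bigD1 i) //= hu // eqxx mul1r big1 ?addr0; last first.
  move=> k ki; have [kli|ilk] := leqP k i.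
    by rewrite hu // eq_sym (negPf ki) mul0r.
  have nk : (n - k <= m)%N.
    by rewrite -ltnS (leq_trans (ltn_sub2l (ltn_trans ilk (ltn_ord k)) ilk) im).
  rewrite IH ?(leq_trans ji (ltnW ilk)) //.
  case: eqP => [kj|_]; last by rewrite mulr0.
  by move: ilk; rewrite kj ltnNge ji.
by move=> ->; rewrite mxE.
Qed.

(* x U = y U *)
Definition cosetU_rel (x y : G) := (x^-1 * y)%g \in unipotent.

Fact cosetU_refl : reflexive cosetU_rel.
Proof. by move=> x; rewrite /cosetU_rel mulVg unipotent1. Qed.

Fact cosetU_symmetric : symmetric cosetU_rel.
Proof.
suff h x y : cosetU_rel x y -> cosetU_rel y x by move=> x y; apply/idP/idP; exact: h.
by move=> /unipotentV; rewrite invgM invgK.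
Qed.

Fact cosetU_trans : transitive cosetU_rel.
Proof.
move=> y x z xy yz; have := unipotentM xy yz.
by rewrite mulgA -(mulgA x^-1%g) mulgV mulg1.
Qed.

Canonical cosetU_equiv :=
  EquivRel cosetU_rel cosetU_refl cosetU_symmetric cosetU_trans.

Definition GmodU := {eq_quot cosetU_rel}.

HB.instance Definition _ : EqQuotient _ cosetU_rel GmodU :=
  EqQuotient.on GmodU.
HB.instance Definition _ := Choice.on GmodU.
HB.instance Definition _ := isPointed.Build GmodU (\pi_GmodU 1%g).

Lemma repr_cosetU (x : G) :
  exists2 u, u \in unipotent & repr (\pi_GmodU x) = (x * u)%g.
Proof.
exists (x^-1 * repr (\pi_GmodU x))%g; last by rewrite mulgA mulgV mul1g.
by have /eqmodP := esym (reprK (\pi_GmodU x)).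
Qed.

Definition actGU (g : G) (p : GmodU) : GmodU := \pi_GmodU (g * repr p)%g.

Lemma actGU_pi (g x : G) : actGU g (\pi_GmodU x) = \pi_GmodU (g * x)%g.
Proof.
rewrite /actGU; have [u uU ->] := repr_cosetU x; apply/eqmodP => /=.
by rewrite /cosetU_rel !invgM !mulgA -(mulgA _ g^-1%g) mulVg mulg1
  -(mulgA _ x^-1%g) mulVg mulg1 unipotentV.
Qed.

(* C[G], G being closed in the affine space of matrices. *)
Inductive regularG : (G -> C) -> Prop :=
| regularG_cst c : regularG (fun=> c)
| regularG_entry i j : regularG (fun x => slval x i j)
| regularG_add f g : regularG f -> regularG g -> regularG (fun x => f x + g x)
| regularG_mul f g : regularG f -> regularG g -> regularG (fun x => f x * g x).

Definition regularGU : {pred GmodU -> C} :=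
  [pred f : GmodU -> C | `[< regularG (fun x => f (\pi_GmodU x)) >]].

Lemma regularGUP (f : GmodU -> C) :
  reflect (regularG (fun x => f (\pi_GmodU x))) (f \in regularGU).
Proof. exact: asboolP. Qed.

Fact regularGU_subring : subring_closed regularGU.
Proof.
split=> [|f g /regularGUP hf /regularGUP hg|f g /regularGUP hf /regularGUP hg].
- by apply/regularGUP; exact: (regularG_cst 1).
- apply/regularGUP; rewrite (_ : (fun _ => _) =
    (fun x => f (\pi_GmodU x) + (fun y => (fun=> -1) y * g (\pi_GmodU y)) x)).
    by apply: regularG_add => //; apply: regularG_mul => //; exact: regularG_cst.
  by apply/funext => x; rewrite mulN1r.
- by apply/regularGUP; exact: (regularG_mul hf hg).
Qed.

HB.instance Definition _ :=
  GRing.isSubringClosed.Build (GmodU -> C) regularGU regularGU_subring.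

(* C[G/U]: pullback along G -> G/U identifies it with the ring C[G]^U of right
   U-invariant regular functions on G. *)
Record coordGU := CoordGU
  { coordfun :> GmodU -> C ; _ : coordfun \in regularGU }.

HB.instance Definition _ := [isSub for coordfun].
HB.instance Definition _ := [Choice of coordGU by <:].
HB.instance Definition _ := [SubChoice_isSubComNzRing of coordGU by <:].

Lemma coordGU_regular (f : coordGU) : regularG (fun x => f (\pi_GmodU x)).
Proof. by case: f => f /= /regularGUP. Qed.

Lemma coordGU_ext (f g : coordGU) :
  (forall x : G, f (\pi_GmodU x) = g (\pi_GmodU x)) -> f = g.
Proof.
by move=> fg; apply/val_inj/funext => p /=; rewrite -[p]reprK; exact: fg.
Qed.

End HomogeneousSpace.

Section Integrality.
Variable R : realType.
Local Notation C := R[i].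

Lemma poly_eq0_horner (p : {poly C}) : (forall s, p.[s] = 0) -> p = 0.
Proof.
move=> p0; apply/eqP; apply: contraT => pn0.
have := max_poly_roots pn0 (rs := [seq k%:R | k <- iota 0 (size p)]).
rewrite size_map size_iota ltnn => -> //.
  by apply/allP => s _; rewrite /root p0.
by rewrite map_inj_uniq ?iota_uniq //; exact: (mulrIn (oner_neq0 _)).
Qed.

(* The line from x to y in the space of matrices, pushed back into SL by
   rescaling the first row. *)
Lemma regularG_line n (x y : SL R n) : exists (d : {poly C}) (z : C -> SL R n),
  [/\ d.[0] = 1, d.[1] = 1, z 0 = x, z 1 = y &
     forall f, regularG f -> exists (N : nat) (p : {poly C}),
       forall s, d.[s] != 0 -> p.[s] = d.[s] ^+ N * f (z s)].
Proof.
case: n => [|n] in x y *.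
  have xy : x = y by apply/val_inj/matrixP => -[].
  exists 1, (fun=> x); split=> //; rewrite ?hornerC // => f hf.
  by exists 0%N, (f x)%:P => s _; rewrite hornerC mul1r.
pose P : 'M[{poly C}]_n.+1 :=
  \matrix_(i, j) ((slval x i j)%:P + 'X * (slval y i j - slval x i j)%:P).
pose Ps s : 'M[C]_n.+1 := map_mx (horner_eval s) P.
pose d := \det P.
have PsE s i j : Ps s i j = slval x i j + s * (slval y i j - slval x i j).
  by rewrite !mxE /horner_eval !hornerE.
have detPs s : \det (Ps s) = d.[s] by rewrite det_map_mx.
have Ps0 : Ps 0 = slval x by apply/matrixP => i j; rewrite PsE mul0r addr0.
have Ps1 : Ps 1 = slval y by apply/matrixP => i j; rewrite PsE mul1r addrC subrK.
have d0 : d.[0] = 1 by rewrite -detPs Ps0 det_SL.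
have d1 : d.[1] = 1 by rewrite -detPs Ps1 det_SL.
pose Z s := diag_mx (\row_i (if i == ord0 then d.[s]^-1 else 1)) *m Ps s.
have ZE s i j : Z s i j = (if i == ord0 then d.[s]^-1 else 1) * Ps s i j.
  by rewrite /Z mul_diag_mx !mxE.
have detZ s : d.[s] != 0 -> \det (Z s) == 1.
  move=> ds; rewrite det_mulmx detPs det_diag (bigD1 ord0) //= mxE eqxx big1.
    by rewrite mulr1 mulVf.
  by move=> i /negPf i0; rewrite mxE i0.
pose z s := insubd x (Z s) : SL R n.+1.
have zE s : d.[s] != 0 -> slval (z s) = Z s.
  by move=> ds; rewrite /z insubdK //; exact: detZ.
have Z1 s : d.[s] = 1 -> Z s = Ps s.
  by move=> ds; apply/matrixP => i j; rewrite ZE ds invr1 if_same mul1r.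
exists d, z; split=> //.
- by apply/val_inj => /=; rewrite zE ?d0 ?oner_eq0 // Z1.
- by apply/val_inj => /=; rewrite zE ?d1 ?oner_eq0 // Z1.
move=> f; elim=> [c|i j|{}f g _ [N [p hp]] _ [M [q hq]]
                 |{}f g _ [N [p hp]] _ [M [q hq]]].
- by exists 0%N, c%:P => s _; rewrite hornerC mul1r.
- exists 1%N, (if i == ord0 then P i j else d * P i j) => s ds.
  rewrite zE // ZE; case: eqP => _.
    by rewrite expr1 mulrA mulfV // mul1r [RHS]mxE.
  by rewrite expr1 mul1r hornerM [Ps s i j]mxE.
- exists (N + M)%N, (d ^+ M * p + d ^+ N * q) => s ds.
  by rewrite !hornerE hp // hq // mulrDr exprD !mulrA
    [d.[s] ^+ M * _]mulrC.
- exists (N + M)%N, (p * q) => s ds.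
  by rewrite hornerM hp // hq // exprD mulrACA.
Qed.

Lemma regularG_integral n (f g : SL R n -> C) : regularG f -> regularG g ->
  (forall x, f x * g x = 0) -> (forall x, f x = 0) \/ (forall x, g x = 0).
Proof.
move=> hf hg fg; apply: contrapT => /not_orP[/existsNP[x fx] /existsNP[y gy]].
have [d [z [d0 d1 z0 z1 hz]]] := regularG_line x y.
have [N [p hp]] := hz f hf; have [M [q hq]] := hz g hg.
have /eqP : p * q * d = 0.
  apply: poly_eq0_horner => s; rewrite !hornerM.
  have [->|ds] := eqVneq d.[s] 0; first by rewrite mulr0.
  by rewrite hp // hq // mulrACA fg mulr0 mul0r.
rewrite !mulf_eq0 => /orP[/orP[]|] /eqP h.
- by apply: fx; have := hp 0; rewrite h horner0 d0 oner_eq0 expr1n mul1r z0 => ->.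
- by apply: gy; have := hq 1; rewrite h horner0 d1 oner_eq0 expr1n mul1r z1 => ->.
- by move: d0; rewrite h horner0 => /esym/eqP; rewrite oner_eq0.
Qed.

End Integrality.

Lemma frac_numden (A : idomainType) (h : {fraction A}) :
  h = FracField.tofrac \n_(repr h) / FracField.tofrac \d_(repr h).
Proof.
have d0 : \d_(repr h) != 0 by exact: denom_ratioP.
apply: (mulIf (x := FracField.tofrac \d_(repr h))); first by rewrite tofrac_eq0.
rewrite mulfVK ?tofrac_eq0 // -[X in X * _]reprK; unlock FracField.tofrac.
rewrite -[LHS]FracField.pi_mul; apply/eqmodP.
rewrite /= FracField.equivfE /FracField.mulf !numden_Ratio ?oner_eq0 ?mulr1 //.
by rewrite mulrC.
Qed.

Lemma frac_map_div (A : idomainType) (F : A -> A) :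
  {morph F : x y / x * y} -> (forall x, F x = 0 -> x = 0) ->
  forall a b : A, b != 0 ->
  let h : {fraction A} := FracField.tofrac a / FracField.tofrac b in
  FracField.tofrac (F \n_(repr h)) / FracField.tofrac (F \d_(repr h)) =
  FracField.tofrac (F a) / FracField.tofrac (F b) :> {fraction A}.
Proof.
move=> FM F0 a b b0 h.
have d0 : \d_(repr h) != 0 by exact: denom_ratioP.
have Fn0 k : k != 0 -> FracField.tofrac (F k) != 0.
  by rewrite tofrac_eq0; apply: contra_neq => /F0.
have /eqP := frac_numden h.
rewrite {1}/h eqr_div ?tofrac_eq0 // -!tofracM tofrac_eq => /eqP E.
apply/eqP; rewrite eqr_div ?Fn0 // -!tofracM tofrac_eq -!FM E.
by rewrite mulrC.
Qed.

Section FunctionField.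
Variables (R : realType) (n : nat).
Local Notation C := R[i].
Local Notation G := (SL R n).
Local Notation GmodU := (GmodU R n).
Local Notation coordGU := (coordGU R n).

Definition coordGU_unit : {pred coordGU} :=
  [pred f : coordGU | `[< exists g, g * f = 1 >]].
Definition coordGU_inv (f : coordGU) : coordGU :=
  if pselect (exists g, g * f = 1) is left h then projT1 (cid h) else f.

Fact coordGU_mulVr : {in coordGU_unit, left_inverse 1 coordGU_inv *%R}.
Proof.
move=> f /asboolP hf; rewrite /coordGU_inv; case: pselect => // h.
by case: cid.
Qed.
Fact coordGU_unitP f g : g * f = 1 -> f \in coordGU_unit.
Proof. by move=> gf; apply/asboolP; exists g. Qed.
Fact coordGU_inv_out : {in [predC coordGU_unit], coordGU_inv =1 id}.
Proof.
move=> f /asboolP hf; rewrite /coordGU_inv; case: pselect => // h.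
Qed.

HB.instance Definition _ := GRing.ComNzRing_hasMulInverse.Build coordGU
  coordGU_mulVr coordGU_unitP coordGU_inv_out.

Fact coordGU_integral : GRing.integral_domain_axiom coordGU.
Proof.
move=> f g fg; have := regularG_integral (coordGU_regular f) (coordGU_regular g).
case=> [x|h|h].
- exact: (congr1 (fun k : coordGU => k (\pi_GmodU x)) fg).
- by apply/orP; left; apply/eqP/coordGU_ext.
- by apply/orP; right; apply/eqP/coordGU_ext.
Qed.

HB.instance Definition _ :=
  GRing.ComUnitRing_isIntegral.Build coordGU coordGU_integral.

(* C(G/U): as G/U is quasi-affine, its rational functions are the quotients of
   global regular functions. *)
Definition ratGU := {fraction coordGU}.

Fact cstGU_subproof (c : C) : (fun=> c) \in @regularGU R n.
Proof. by apply/regularGUP; exact: regularG_cst. Qed.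
Definition cstGU (c : C) : coordGU := CoordGU (cstGU_subproof c).

Lemma regularG_translate (g : G) (f : G -> C) :
  regularG f -> regularG (fun x => f (g * x)%g).
Proof.
elim=> [c|i j|{}f h _ hf _ hh|{}f h _ hf _ hh].
- exact: regularG_cst.
- rewrite (_ : (fun _ => _) = (fun x => \sum_k slval g i k * slval x k j)).
    elim: (index_enum _) => [|k r hr].
      by under eq_fun do rewrite big_nil; exact: regularG_cst.
    under eq_fun do rewrite big_cons.
    apply: regularG_add hr; apply: regularG_mul; first exact: regularG_cst.
    exact: regularG_entry.
  by apply/funext => x; rewrite slvalM mxE.
- exact: (regularG_add hf hh).
- exact: (regularG_mul hf hh).
Qed.

Fact act_coord_subproof (g : G) (f : coordGU) :
  (fun p => f (actGU g^-1%g p)) \in @regularGU R n.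
Proof.
apply/regularGUP; under eq_fun do rewrite actGU_pi.
exact: (regularG_translate _ (coordGU_regular f)).
Qed.

Definition act_coord (g : G) (f : coordGU) : coordGU :=
  CoordGU (act_coord_subproof g f).

(* The induced action on the fraction field; see act_ratE. *)
Definition act_rat (g : G) (h : ratGU) : ratGU :=
  FracField.tofrac (act_coord g \n_(repr h))
    / FracField.tofrac (act_coord g \d_(repr h)).

Lemma act_coordM (g : G) : {morph act_coord g : a b / a * b}.
Proof. by move=> a b; apply/val_inj. Qed.

Lemma act_coord_eq0 (g : G) (a : coordGU) : act_coord g a = 0 -> a = 0.
Proof.
move=> a0; apply: coordGU_ext => x.
have := congr1 (fun k : coordGU => k (\pi_GmodU (g * x)%g)) a0.
by rewrite /= actGU_pi mulKg.
Qed.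

Lemma act_ratE (g : G) (a b : coordGU) : b != 0 ->
  act_rat g (FracField.tofrac a / FracField.tofrac b) =
  FracField.tofrac (act_coord g a) / FracField.tofrac (act_coord g b).
Proof.
move=> b0; apply: frac_map_div => //; first exact: act_coordM.
by move=> k; exact: act_coord_eq0.
Qed.

End FunctionField.

Section FlagMinors.
Variables (R : realType) (n : nat).
Local Notation C := R[i].
Local Notation G := (SL R n).
Local Notation GmodU := (GmodU R n).

(* Rows I and columns J, each listed in increasing order; the default of nth is
   never reached when #|I| = #|J|. *)
Definition minor (x : 'M[C]_n) (I J : {set 'I_n}) : C :=
  \det (\matrix_(a < #|I|, b < #|I|) x (enum_val a) (nth (enum_val a) (enum J) b)).

Definition first_cols (k : nat) : {set 'I_n} := [set j : 'I_n | (j < k)%N]%SET.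

Definition flag_minor (I : {set 'I_n}) (p : GmodU) : C :=
  minor (slval (repr p)) I (first_cols #|I|).

Lemma minor_first_cols (x : 'M[C]_n) (I : {set 'I_n}) (kn : (#|I| <= n)%N) :
  minor x I (first_cols #|I|) =
  \det (\matrix_(a < #|I|, b < #|I|) x (enum_val a) (widen_ord kn b)).
Proof.
congr (\det _); apply/matrixP => a b; rewrite !mxE; congr (x _ _).
have E : map val (enum (first_cols #|I|)) = iota 0 #|I|.
  rewrite /enum_mem -enumT.
  rewrite (eq_filter (a2 := preim val (fun i => (i < #|I|)%N))); last first.
    by move=> j; exact: (finset.in_set (fun j : 'I_n => (j < #|I|)%N) j).
  by rewrite -filter_map val_enum_ord (filter_iota_ltn 0 kn).
apply/val_inj => /=; rewrite -(nth_map _ (val (enum_val a))) ?E ?nth_iota //.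
by rewrite -(size_map val) E size_iota.
Qed.

Lemma flag_minor_pi (I : {set 'I_n}) (x : G) :
  flag_minor I (\pi_GmodU x) = minor (slval x) I (first_cols #|I|).
Proof.
have kn : (#|I| <= n)%N by rewrite -[X in (_ <= X)%N]card_ord max_card.
have [u /unipotentP uU xu] := repr_cosetU x.
rewrite /flag_minor xu !(minor_first_cols _ kn).
pose W : 'M[C]_#|I| := \matrix_(c, b) slval u (widen_ord kn c) (widen_ord kn b).
have W1 : \det W = 1.
  rewrite -det_tr det_trig; last first.
    apply/is_trig_mxP => b c bc; rewrite !mxE uU ?(ltnW bc) //=.
    by case: eqP => // /(congr1 val) /= cb; rewrite cb ltnn in bc.
  by rewrite big1 // => b _; rewrite !mxE uU // eqxx.
rewrite -[RHS]mulr1 -W1 -det_mulmx; congr (\det _); apply/matrixP => a b.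
rewrite !mxE (bigID (fun l : 'I_n => (l < #|I|)%N)) /=.
rewrite (big_ord_narrow kn) [X in _ + X]big1 ?addr0; last first.
  move=> l; rewrite -leqNgt => kl.
  have bl : (b < l)%N by exact: leq_trans kl.
  rewrite uU ?(ltnW bl) //; case: eqP => [lb|_]; last by rewrite mulr0.
  by rewrite lb /= ltnn in bl.
by apply: eq_bigr => c _; rewrite !mxE.
Qed.

(* phi i is the spherical function of the fundamental weight omega_(i+1). *)
Definition phi (i : 'I_n.-1) (p : GmodU) : R :=
  \sum_(I : {set 'I_n} | #|I| == i.+1) ComplexField.Normc.normc (flag_minor I p) ^+ 2.

Definition logt (t y : R) : R := ln y / ln t.

Definition sLog (t : R) (p : GmodU) : 'rV[R]_n.-1 := \row_i logt t (phi i p).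

End FlagMinors.

Section Borel.
Variables (R : realType) (n : nat).
Local Notation C := R[i].
Local Notation G := (SL R n).

Definition is_subgroup (H : set G) : Prop :=
  [/\ H 1%g, forall x y, H x -> H y -> H (x * y)%g & forall x, H x -> H x^-1%g].

Definition derived (H : set G) : set G :=
  smallest is_subgroup [set [~ x, y]%g | x in H & y in H].

Definition is_solvable (H : set G) : Prop :=
  exists k, iter k derived H = [set 1%g].

Definition zariski_closed (A : set G) : Prop :=
  exists2 S : set (G -> C), S `<=` @regularG R n &
    A = [set x | forall f, S f -> f x = 0].

Definition zariski_connected (A : set G) : Prop :=
  A !=set0 /\
  forall D E, zariski_closed D -> zariski_closed E ->
    A `<=` D `|` E -> A `&` (D `&` E) = set0 -> A `<=` D \/ A `<=` E.

Definition connected_solvable_closed (H : set G) : Prop :=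
  [/\ is_subgroup H, zariski_closed H, zariski_connected H & is_solvable H].

(* Borel subgroup: maximal among the closed connected solvable subgroups. *)
Definition is_borel (B : set G) : Prop :=
  connected_solvable_closed B /\
  forall H, connected_solvable_closed H -> B `<=` H -> H = B.

End Borel.

Section ValuationCone.
Variables (R : realType) (n : nat).
Local Notation C := R[i].
Local Notation G := (SL R n).
Local Notation coordGU := (coordGU R n).
Local Notation ratGU := (ratGU R n).

(* v is a map K^* -> Q: its value at 0 is irrelevant. Discreteness says that the
   value group is cyclic, which allows the zero valuation. *)
Definition discrete_valuation (K : fieldType) (v : K -> rat) : Prop :=
  [/\ forall f g : K, f != 0 -> g != 0 -> v (f * g) = v f + v g,
      forall f g : K, f != 0 -> g != 0 -> f + g != 0 ->
        Num.min (v f) (v g) <= v (f + g)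
    & exists q : rat, forall f : K, f != 0 -> exists m : int, v f = m%:~R * q].

Definition invariant_valuation (v : ratGU -> rat) : Prop :=
  [/\ discrete_valuation v,
      forall c : C, c != 0 -> v (FracField.tofrac (cstGU n c)) = 0
    & forall (g : G) (f : ratGU), f != 0 -> v (act_rat g f) = v f].

(* The G-submodule of C[G/U] spanned by the k x k flag minors. *)
Definition flag_module (k : nat) : set coordGU :=
  [set f : coordGU | exists c : {set 'I_n} -> C,
     forall p, f p = \sum_(I : {set 'I_n} | #|I| == k) c I * flag_minor I p].

Definition eigenvector (B : set G) (f : coordGU) : Prop :=
  f != 0 /\ forall b, B b -> exists c : C, act_coord b f = cstGU n c * f.

Definition valuation_cone (B : set G) : set 'rV[rat]_n.-1 :=
  [set a : 'rV[rat]_n.-1 | exists v : ratGU -> rat, invariant_valuation v /\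
     exists f : 'I_n.-1 -> coordGU,
       forall i : 'I_n.-1, [/\ flag_module i.+1 (f i), eigenvector B (f i)
                   & a 0 i = v (FracField.tofrac (f i))]].

Definition real_valuation_cone (B : set G) : set 'rV[R]_n.-1 :=
  closure [set map_mx (@ratr R) a | a in valuation_cone B].

End ValuationCone.

(* Main.v *)
Require Import Defs.
From mathcomp Require Import all_boot all_order all_algebra all_fingroup.
From mathcomp Require Import generic_quotient fraction complex.
From mathcomp Require Import boolp classical_sets reals topology normedtype.
From mathcomp Require Import sequences exp.

(** Surjectivity of the spherical logarithm is visible on the diagonal matrices
    with positive entries d_1, ..., d_n of product 1, where phi_i is
    (d_1 ... d_i)^2.

    For the valuation cone it suffices to realise every rational vector. A
    one-parameter subgroup cochar of the diagonal torus normalises U and acts on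
    G/U on the right, commuting with G; the order at s = 0 of f (x . cochar s),
    minimised over x, is therefore a G-invariant valuation, and it takes a
    prescribed integer value on all nonzero combinations of i x i flag minors.
    Dividing by a common denominator gives all rational vectors.

    The Borel subgroup enters only through the existence of its eigenvectors. By
    the Lie-Kolchin theorem it is triangular in some basis, given by the rows of
    a matrix P, and then the upper left i x i minor of P x is an eigenvector. *)

Set Implicit Arguments.
Unset Strict Implicit.
Unset Printing Implicit Defensive.

Import Order.TTheory GRing.Theory Num.Theory.
Import numFieldNormedType.Exports.

Local Open Scope ring_scope.
Local Open Scope quotient_scope.
Local Open Scope classical_set_scope.
Local Open Scope complex_scope.

(** * Regular functions and connectedness *)

Section RegularFunctions.
Variables (R : realType) (n : nat).
Local Notation C := R[i].
Local Notation G := (SL R n).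
Implicit Types f g : G -> C.

Lemma regularG_ext f g : regularG f -> f =1 g -> regularG g.
Proof. by move=> + /funext <-. Qed.

Lemma regularG_scale c f : regularG f -> regularG (fun x => c * f x).
Proof. exact/regularG_mul/regularG_cst. Qed.

Lemma regularG_sum (I : Type) (r : seq I) (P : pred I) (F : I -> G -> C) :
  (forall i, P i -> regularG (F i)) ->
  regularG (fun x => \sum_(i <- r | P i) F i x).
Proof.
move=> hF; elim: r => [|i r IH].
  by apply: (regularG_ext (regularG_cst n (0 : C))) => x; rewrite big_nil.
apply: (@regularG_ext
  (fun x => (if P i then F i x else 0) + \sum_(j <- r | P j) F j x)); last first.
  by move=> x; rewrite big_cons; case: (P i); rewrite ?add0r.
apply: regularG_add IH; case: (P i) (@hF i) => [/(_ isT) //|_].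
exact: regularG_cst.
Qed.

Lemma regularG_prod (I : Type) (r : seq I) (P : pred I) (F : I -> G -> C) :
  (forall i, P i -> regularG (F i)) ->
  regularG (fun x => \prod_(i <- r | P i) F i x).
Proof.
move=> hF; elim: r => [|i r IH].
  by apply: (regularG_ext (regularG_cst n (1 : C))) => x; rewrite big_nil.
apply: (@regularG_ext
  (fun x => (if P i then F i x else 1) * \prod_(j <- r | P j) F j x)); last first.
  by move=> x; rewrite big_cons; case: (P i); rewrite ?mul1r.
apply: regularG_mul IH; case: (P i) (@hF i) => [/(_ isT) //|_].
exact: regularG_cst.
Qed.

Lemma regularG_horner (p : {poly C}) f :
  regularG f -> regularG (fun x => p.[f x]).
Proof.
move=> hf; elim/poly_ind: p => [|p c IH].
  by apply: (regularG_ext (regularG_cst n (0 : C))) => x; rewrite horner0.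
apply: (@regularG_ext (fun x => p.[f x] * f x + c)); last first.
  by move=> x; rewrite !hornerE.
exact/regularG_add/regularG_cst/regularG_mul.
Qed.

Definition regular_mx p q (M : G -> 'M[C]_(p, q)) :=
  forall i j, regularG (fun x => M x i j).

Lemma regular_mx_cst p q (A : 'M[C]_(p, q)) : regular_mx (fun=> A).
Proof. by move=> i j; exact: regularG_cst. Qed.

Lemma regular_mx_slval : regular_mx (fun x : G => slval x).
Proof. exact: regularG_entry. Qed.

Lemma regular_mx_mul p q r (M : G -> 'M[C]_(p, q)) (N : G -> 'M[C]_(q, r)) :
  regular_mx M -> regular_mx N -> regular_mx (fun x => M x *m N x).
Proof.
move=> hM hN i j; apply: (@regularG_ext (fun x => \sum_k M x i k * N x k j)); last first.
  by move=> x; rewrite mxE.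
by apply: regularG_sum => k _; exact: regularG_mul.
Qed.

Lemma regularG_det p (M : G -> 'M[C]_p) :
  regular_mx M -> regularG (fun x => \det (M x)).
Proof.
move=> hM; apply: regularG_sum => s _; apply: regularG_scale.
by apply: regularG_prod => i _; exact: hM.
Qed.

(** As the determinant is 1, the inverse is the adjugate, whose entries are polynomials in those of
    x. *)
Lemma regular_mx_inv : regular_mx (fun x : G => slval x^-1%g).
Proof.
move=> i j.
apply: (@regularG_ext (fun x : G => cofactor (slval x) j i)); last first.
  by move=> x; rewrite /= /invmx SL_unitmx det_SL invr1 scale1r mxE.
apply/regularG_scale/regularG_det => k l.
apply: (regularG_ext (@regularG_entry _ _ (lift j k) (lift i l))) => x.
by rewrite !mxE.
Qed.

Definition regular_map (h : G -> G) := regular_mx (fun x => slval (h x)).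

Lemma regular_map_id : regular_map id.
Proof. exact: regularG_entry. Qed.

Lemma regular_map_cst y : regular_map (fun=> y).
Proof. exact: regular_mx_cst. Qed.

Lemma regular_mapM h k :
  regular_map h -> regular_map k -> regular_map (fun x => h x * k x)%g.
Proof. exact: regular_mx_mul. Qed.

Lemma regularG_comp f h : regularG f -> regular_map h -> regularG (f \o h).
Proof.
move=> hf hh; elim: hf => [c|i j|{}f g _ hf _ hg|{}f g _ hf _ hg].
- exact: regularG_cst.
- exact: hh.
- exact: regularG_add.
- exact: regularG_mul.
Qed.

Lemma regular_map_comm y z : regular_map (fun x => [~ x, y] * z)%g.
Proof.
rewrite /commg /conjg; repeat apply: regular_mapM;
  by [exact: regular_map_cst | exact: regular_map_id | exact: regular_mx_inv].
Qed.

Lemma zariski_closed_preimage (D : set G) h :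
  regular_map h -> zariski_closed D -> zariski_closed [set x | D (h x)].
Proof.
move=> hh [S hS ->]; exists [set f \o h | f in S].
  by move=> _ [f Sf <-]; exact: regularG_comp (hS _ Sf) hh.
apply/seteqP; split=> x /= hx; first by move=> _ [f Sf <-]; exact: hx.
by move=> f Sf; apply: (hx (f \o h)); exists f.
Qed.

Lemma zariski_closed_zero f : regularG f -> zariski_closed [set x | f x = 0].
Proof.
move=> hf; exists [set f]; first by move=> _ ->.
by apply/seteqP; split=> x /= => [fx _ -> //|]; exact.
Qed.

(* Writing p = ('X - f x) ^ k * q with q.[f x] != 0, the set A is covered by the
   disjoint closed sets f = f x and q.[f] = 0. *)
Lemma connected_constant (A : set G) f (p : {poly C}) :
  zariski_connected A -> regularG f -> p != 0 ->
  (forall x, A x -> p.[f x] = 0) ->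
  forall x y, A x -> A y -> f x = f y.
Proof.
move=> [_ conA] hf p0 pf x y Ax Ay.
have [k [q /implyP/(_ p0) qx pE]] := multiplicity_XsubC p (f x).
have := conA [set z | f z - f x = 0] [set z | q.[f z] = 0].
case.
- apply: zariski_closed_zero; apply: regularG_add hf (regularG_cst _ _).
- exact/zariski_closed_zero/regularG_horner.
- move=> z /pf /eqP; rewrite pE hornerM mulf_eq0 => /orP[/eqP ?|]; first by right.
  by rewrite horner_exp hornerXsubC expf_eq0 => /andP[_ /eqP ?]; left.
- apply/seteqP; split=> z //= -[_ [/subr0_eq -> /eqP]].
  by rewrite -[_ == 0]/(root q (f x)) (negPf qx).
- by move=> /(_ y Ay) /= /subr0_eq ->.
- by move=> /(_ x Ax) /= /eqP; rewrite -[_ == 0]/(root q (f x)) (negPf qx).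
Qed.

End RegularFunctions.

Arguments regular_mx_cst {R n p q} A.
Arguments regular_mx_inv {R n}.
Arguments regular_map_id {R n}.

(** * Derived subgroups and their connectedness *)

Section Derived.
Variables (R : realType) (n : nat).
Local Notation G := (SL R n).
Implicit Types H K : set G.

Lemma derived_subgroup H : is_subgroup (derived H).
Proof.
split.
- by move=> K -[] [].
- move=> x y hx hy K hK; have [[_ KM _] _] := hK.
  exact: (KM _ _ (hx K hK) (hy K hK)).
- by move=> x hx K hK; have [[_ _ KV] _] := hK; exact: (KV _ (hx K hK)).
Qed.

Lemma derived_comm H x y : H x -> H y -> derived H [~ x, y]%g.
Proof. by move=> Hx Hy; apply: sub_gen_smallest; exists x => //; exists y. Qed.

Lemma derived_min H K : is_subgroup K ->
  (forall x y, H x -> H y -> K [~ x, y]%g) -> derived H `<=` K.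
Proof.
move=> sK hK; apply: smallest_sub => // _ [x Hx [y Hy <-]]; exact: hK.
Qed.

Lemma derived_sub H : is_subgroup H -> derived H `<=` H.
Proof.
move=> sH; apply: derived_min => // x y Hx Hy; case: sH => _ HM HV.
exact: HM (HV _ Hx) (HM _ _ (HV _ Hy) (HM _ _ Hx Hy)).
Qed.

Lemma derived_conj H x y : is_subgroup H -> H x -> derived H y ->
  derived H (x * y * x^-1)%g.
Proof.
move=> sH Hx H'y; have [_ HM HV] := derived_subgroup H.
have [_ _ hV] := sH.
rewrite (_ : (_ * _)%g = ([~ x^-1, y^-1] * y)%g).
  apply: (HM _ _ _ H'y); apply: derived_comm; apply: (hV); first exact: Hx.
  exact: derived_sub H'y.
by rewrite commgEl conjgE !invgK !mulgA mulgVK.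
Qed.

(* [x, y] z and z lie in the same part of a clopen partition of the derived
   group, because x ranges over the connected set H, and [1, y] z = z. *)
Lemma connected_derived H : is_subgroup H -> zariski_connected H ->
  zariski_connected (derived H).
Proof.
move=> sH [_ conH]; have sH' := derived_subgroup H.
have [H1 HM HV] := sH'; have [h1 hM hV] := sH.
split; first by exists 1%g.
(* The two parts play symmetric roles, so [D] may be taken to be the one containing 1. *)
suff main D E : zariski_closed D -> zariski_closed E ->
    derived H `<=` D `|` E -> derived H `&` (D `&` E) = set0 -> D 1%g ->
    derived H `<=` D.
  move=> D E cD cE cov dis; have [D1|E1] := cov _ H1.
    by left; exact: main dis D1.
  by right; apply: (main E D); rewrite 1?setUC 1?[E `&` D]setIC.
move=> cD cE cov dis D1.
have notDE z : derived H z -> D z -> E z -> False.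
  by move=> *; suff : (derived H `&` (D `&` E)) z by rewrite dis.
have step D' E' x y z : zariski_closed D' -> zariski_closed E' ->
    derived H `<=` D' `|` E' -> (forall z, derived H z -> D' z -> E' z -> False) ->
    H x -> H y -> derived H z -> D' z -> D' ([~ x, y] * z)%g.
  move=> cD' cE' cov' dis' Hx Hy H'z D'z.
  have comz w : H w -> derived H ([~ w, y] * z)%g.
    by move=> Hw; apply: (HM) => //; exact: derived_comm.
  have [] := conH [set w | D' ([~ w, y] * z)%g] [set w | E' ([~ w, y] * z)%g].
  - exact/zariski_closed_preimage/cD'/regular_map_comm.
  - exact/zariski_closed_preimage/cE'/regular_map_comm.
  - by move=> w /comz /cov'.
  - apply/seteqP; split=> w //= -[/comz Hw []]; exact: dis'.
  - by move=> /(_ x Hx).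
  - move=> /(_ 1%g h1) /=; rewrite comm1g mul1g => E'z.
    by case: (dis' z).
(* [S] consists of the w whose left translation preserves [D] within the derived group. It is a
   subgroup containing all commutators, hence the whole derived group; z = 1 then puts w in [D]. *)
pose S := [set w | derived H w /\ forall z, derived H z -> D z <-> D (w * z)%g].
have sS : is_subgroup S.
  split.
  - by split=> // z _; rewrite mul1g.
  - move=> x y [Hx hx] [Hy hy]; split=> [|z Hz]; first exact: HM.
    by rewrite -mulgA; exact: iff_trans (hy z Hz) (hx _ (HM _ _ Hy Hz)).
  - move=> x [Hx hx]; split=> [|z Hz]; first exact: HV.
    have := hx _ (HM _ _ (HV _ Hx) Hz); rewrite mulVKg => h.
    by split=> /h.
move=> z H'z; suff [_ /(_ 1%g H1)] : S z by rewrite mulg1 => -[+ _]; exact.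
apply: derived_min z H'z => // x y Hx Hy; split=> [|z H'z].
  exact: derived_comm.
split=> [Dz|Dcz]; first exact: (step D E).
have [//|Ez] := cov _ H'z.
have Ecz : E ([~ x, y] * z)%g.
  apply: (step E D) => //; first by rewrite setUC.
  by move=> w Hw Ew Dw; exact: (notDE w).
by case: (notDE _ (HM _ _ (derived_comm Hx Hy) H'z) Dcz Ecz).
Qed.

End Derived.

(** * The Lie-Kolchin theorem *)

(** Choose [W] of maximal rank among the matrices with row space inside [P]: a vector of [P] outside
    that space could be adjoined and would raise the rank. *)
Lemma linear_pred_mx (F : fieldType) m (P : 'rV[F]_m -> Prop) :
  P 0 -> (forall a u w, P u -> P w -> P (a *: u + w)) ->
  exists W : 'M[F]_m, forall w, P w <-> (w <= W)%MS.
Proof.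
move=> P0 PD.
pose S k := `[< exists W : 'M[F]_m, \rank W = k /\
                  forall w : 'rV_m, (w <= W)%MS -> P w >].
have S0 : exists k, S k.
  exists 0%N; apply/asboolP; exists 0; split; first exact: mxrank0.
  by move=> w; rewrite submx0 => /eqP ->.
have Sm k : S k -> (k <= m)%N by move=> /asboolP[W [<- _]]; exact: rank_leq_row.
case: (ex_maxnP S0 Sm) => k /asboolP[W [rW PW]] kmax.
exists W => w; split=> [Pw|]; last exact: PW.
suff : (W + w <= W)%MS by exact: submx_trans (addsmxSr W w).
rewrite -(mxrank_leqif_sup (addsmxSl W w)) eqn_leq mxrankS ?addsmxSl //= rW.
apply: kmax; apply/asboolP; exists (W + w)%MS; split=> // u.
case/sub_addsmxP => -[A B] /= ->.
rewrite addrC [B]mx11_scalar mul_scalar_mx.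
by apply: PD => //; apply: PW; exact: submxMl.
Qed.

Section LieKolchin.
Variables (R : realType) (n : nat).
Local Notation C := R[i].
Local Notation G := (SL R n).
Implicit Types H : set G.

(** Multiplicativity is asked on [H] only, with [rho] regular on all of [G]: the compression to an
    [H]-stable subspace is in general multiplicative only there. *)
Definition is_rep H m (rho : G -> 'M[C]_m) : Prop :=
  [/\ regular_mx rho, rho 1%g = 1%:M &
      forall x y, H x -> H y -> rho (x * y)%g = rho x *m rho y].

Lemma rep_sub H K m (rho : G -> 'M[C]_m) : K `<=` H -> is_rep H rho -> is_rep K rho.
Proof. by move=> KH [? ? rM]; split=> // x y /KH ? /KH ?; exact: rM. Qed.

Lemma rep_restrict H m (rho : G -> 'M[C]_m) (W : 'M[C]_m) :
  is_rep H rho -> (forall x, H x -> stablemx W (rho x)) ->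
  is_rep H (fun x => restrictmx W (rho x)).
Proof.
move=> [rr r1 rM] sW; split.
- rewrite /conjmx; apply: regular_mx_mul (regular_mx_cst _).
  exact: regular_mx_mul (regular_mx_cst _) rr.
- by rewrite r1 conjmx_scalar ?row_base_free.
- by move=> x y Hx Hy; rewrite rM // conjmxM // inE stablemx_row_base sW.
Qed.

(** The determinant of [rho] is a character of [H] with commuting values, so it kills
    commutators. *)
Lemma derived_det_rep H m (rho : G -> 'M[C]_m) y : is_subgroup H ->
  is_rep H rho -> derived H y -> \det (rho y) = 1.
Proof.
move=> [H1 HM HV] [_ r1 rM].
have detV z : H z -> \det (rho z^-1%g) * \det (rho z) = 1.
  by move=> Hz; rewrite -det_mulmx -rM ?mulVg ?r1 ?det1 //; exact: HV.
pose S := [set z | H z /\ \det (rho z) = 1].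
suff sub : derived H `<=` S by move=> /sub[].
apply: derived_min => [|a b Ha Hb].
  split.
  - by split=> //; rewrite r1 det1.
  - move=> a b [Ha da] [Hb db]; split; first exact: HM.
    by rewrite rM // det_mulmx da db mulr1.
  - move=> a [Ha da]; split; first exact: HV.
    by rewrite -(detV a Ha) da mulr1.
have Ha' := HV _ Ha; have Hb' := HV _ Hb.
have Hab := HM _ _ Ha Hb; have Hbab := HM _ _ Hb' Hab.
split; first exact: HM.
by rewrite /commg /conjg !rM // !det_mulmx (mulrCA _ _ (\det (rho b))) detV //
  mulr1 detV.
Qed.

Lemma rep_unit H m (rho : G -> 'M[C]_m) x : is_subgroup H ->
  is_rep H rho -> H x -> rho x \in unitmx.
Proof.
move=> [_ _ HV] [_ r1 rM] Hx; have := r1; rewrite -(mulgV x) rM //; last exact: HV.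
by case/mulmx1_unit.
Qed.

Lemma rep_conj H m (rho : G -> 'M[C]_m) x y : is_subgroup H -> is_rep H rho ->
  H x -> H y -> rho x *m rho y = rho (x * y * x^-1)%g *m rho x.
Proof.
move=> [_ HM HV] [_ _ rM] Hx Hy.
by rewrite -!rM ?mulgVK //; exact: HM (HM _ _ Hx Hy) (HV _ Hx).
Qed.

(* The weight chi of an eigenvector of the derived group is invariant under
   conjugation by the connected group H, as its values on the conjugates of y
   are eigenvalues of rho y. *)
Lemma weight_conj H m (rho : G -> 'M[C]_m) (v : 'rV[C]_m) (chi : G -> C) :
  is_subgroup H -> zariski_connected H -> is_rep H rho ->
  v != 0 -> regularG chi ->
  (forall y, derived H y -> v *m rho y = chi y *: v) ->
  forall x y, H x -> derived H y -> chi (x * y * x^-1)%g = chi y.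
Proof.
move=> sH conH rep v0 rchi hchi x y Hx H'y.
have [_ _ rM] := rep; have [H1 HM HV] := sH.
have Hy := derived_sub sH H'y.
have E : chi (x * y * x^-1)%g = chi (1 * y * 1^-1)%g.
  apply: (connected_constant (f := fun x => chi (x * y * x^-1)%g)
    (p := char_poly (rho y)) conH) => //.
  - apply: (regularG_comp (h := fun x => (x * y * x^-1)%g) rchi).
    apply: regular_mapM regular_mx_inv.
    exact: regular_mapM regular_map_id (regular_map_cst y).
  - exact/monic_neq0/char_poly_monic.
  - move=> z Hz; apply/eqP; rewrite -[_ == 0]/(root _ _) -eigenvalue_root_char.
    apply/eigenvalueP; exists (v *m rho z); last first.
      by rewrite mulmx_free_eq0 // row_free_unit (rep_unit sH rep).
    rewrite -mulmxA (rep_conj sH rep) //.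
    by rewrite mulmxA (hchi (z * y * z^-1)%g) ?scalemxAl //; exact: derived_conj.
by rewrite E mul1g invg1 mulg1.
Qed.

Definition irreducible_rep H m (rho : G -> 'M[C]_m) :=
  forall W : 'M[C]_m, (forall x, H x -> stablemx W (rho x)) -> W != 0 ->
  row_full W.

(** The weight [chi] of [v] is invariant under conjugation, so its weight space is [H]-stable, hence
    everything. The derived group thus acts by scalars of determinant 1, that is by m-th roots of
    unity, and by connectedness they all equal the value of [chi] at the identity. *)
Lemma irreducible_derived_trivial H m (rho : G -> 'M[C]_m) (v : 'rV[C]_m) :
  is_subgroup H -> zariski_connected H -> is_rep H rho ->
  irreducible_rep H rho -> v != 0 ->
  (forall y, derived H y -> stablemx v (rho y)) ->
  forall y, derived H y -> rho y = 1%:M.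
Proof.
move=> sH conH rep irr v0 stv.
have [rr r1 rM] := rep; have [H1 HM HV] := sH.
have [j vj] : exists j, v 0 j != 0 by apply/rV0Pn.
have m0 : (0 < m)%N := leq_ltn_trans (leq0n j) (ltn_ord j).
(* Dividing by a nonzero coordinate of [v] makes the weight a regular function on all of [G]. *)
pose chi x := (v *m rho x) 0 j * (v 0 j)^-1.
have rchi : regularG chi.
  apply: regularG_mul (regularG_cst _ _).
  exact: (regular_mx_mul (regular_mx_cst _) rr).
have hchi y : derived H y -> v *m rho y = chi y *: v.
  by move=> /stv /sub_rVP[a E]; rewrite /chi E mxE mulfK.
have chiJ := weight_conj sH conH rep v0 rchi hchi.
have [||W hW] := @linear_pred_mx _ m
  (fun w => forall y, derived H y -> w *m rho y = chi y *: w).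
- by move=> y _; rewrite mul0mx scaler0.
- move=> a u w hu hw y H'y; rewrite mulmxDl -scalemxAl hu // hw // scalerDr.
  by rewrite !scalerA mulrC.
have Wfull : row_full W.
  apply: irr => [x Hx|]; last first.
    apply: contra_neq v0 => W0; apply/eqP; rewrite -submx0 -W0.
    exact/hW.
  apply/row_subP => i; rewrite row_mul; apply/hW => y H'y.
  have /hW hi : (row i W <= W)%MS by exact: row_sub.
  have Hy := derived_sub sH H'y.
  rewrite -mulmxA (rep_conj sH rep) //.
  rewrite mulmxA (hi (x * y * x^-1)%g); last exact: derived_conj.
  by rewrite -scalemxAl chiJ.
have scal y : derived H y -> rho y = (chi y)%:M.
  move=> H'y; apply/row_matrixP => i; rewrite -[rho y]mul1mx row_mul.
  have /hW -> // : (row i (1%:M : 'M[C]_m) <= W)%MS by exact: submx_full.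
  by apply/rowP => l; rewrite !mxE mulr_natr.
move=> y H'y; rewrite scal //; congr (_%:M).
have chi1 : chi 1%g = 1 by rewrite /chi r1 mulmx1 mulfV.
rewrite -chi1; apply: (connected_constant (p := 'X^m - 1)
  (connected_derived sH conH) rchi) => //.
- by rewrite -size_poly_eq0 size_XnsubC.
- move=> z H'z; rewrite !hornerE -(det_scalar m) -scal //.
  by rewrite (derived_det_rep sH rep) // subrr.
- by case: (derived_subgroup H).
Qed.

(** Outer induction on the derived length, inner induction on the dimension. A reducible
    representation is restricted to an invariant subspace; in an irreducible one the derived group
    acts trivially, so the operators commute. *)
Lemma common_eigenvector_solvable k m H (rho : G -> 'M[C]_m) :
  is_subgroup H -> zariski_connected H -> iter k (@derived R n) H = [set 1%g] ->
  is_rep H rho -> (0 < m)%N ->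
  exists2 v : 'rV[C]_m, v != 0 & forall x, H x -> stablemx v (rho x).
Proof.
elim: k => [|k IHk] in m H rho *.
  move=> _ _ /= -> [_ r1 _] m0; exists (const_mx 1).
    by apply/rV0Pn; exists (Ordinal m0); rewrite mxE oner_eq0.
  by move=> _ ->; rewrite r1 mulmx1.
rewrite iterSr => sH conH solH.
elim/ltn_ind: m => m IHm in rho * => rep m0.
have [[W [stW W0 Wn]]|irr] := pselect (exists W : 'M[C]_m,
    [/\ forall x, H x -> stablemx W (rho x), W != 0 & ~~ row_full W]).
  have rW : (\rank W < m)%N by rewrite ltn_neqAle rank_leq_row andbT.
  have [|v v0 stv] := IHm _ rW _ (rep_restrict rep stW).
    by rewrite lt0n mxrank_eq0.
  exists (v *m row_base W); first by rewrite mulmx_free_eq0 ?row_base_free.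
  by move=> x Hx; rewrite -stablemx_restrict ?stv //; exact: stW.
have {}irr : irreducible_rep H rho.
  by move=> W stW W0; apply: contraT => Wn; case: irr; exists W; split.
have [v v0 stv] := IHk _ _ _ (derived_subgroup H) (connected_derived sH conH)
  solH (rep_sub (derived_sub sH) rep) m0.
have triv := irreducible_derived_trivial sH conH rep irr v0 stv.
have [rr r1 rM] := rep; have [H1 HM HV] := sH.
have comm x y : H x -> H y -> comm_mx (rho x) (rho y).
  move=> Hx Hy; have dxy := derived_comm Hx Hy.
  have Hdxy := derived_sub sH dxy.
  rewrite /comm_mx -!rM // [in LHS]commgC [LHS]rM ?(triv _ dxy) ?mulmx1 //.
  exact: HM.
exists v => // x Hx.
(* An eigenspace of [rho x] is stable under the commuting family, hence full, so [rho x] is a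
   scalar. *)
have [a ea] := eigenvalue_closed (rho x) m0.
have full : row_full (eigenspace (rho x) a).
  apply: irr => // y Hy; apply: comm_mx_stable_eigenspace; exact: comm.
by apply/eigenvectorP; exists a; exact: submx_full.
Qed.

(** A common eigenvector is completed to a basis, and the induction hypothesis is applied to the
    quotient by its line. Matrices act on row vectors, so the triangular form is the lower one. *)
Lemma lie_kolchin k m H (rho : G -> 'M[C]_m) :
  is_subgroup H -> zariski_connected H -> iter k (@derived R n) H = [set 1%g] ->
  is_rep H rho ->
  exists2 P : 'M[C]_m, P \in unitmx &
    forall x, H x -> is_trig_mx (P *m rho x *m invmx P).
Proof.
move=> sH conH solH; elim: m => [|m IH] in rho * => rep.
  by exists 1%:M; rewrite ?unitmx1 // => x _; apply/is_trig_mxP => -[].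
have [v v0 stv] := common_eigenvector_solvable sH conH solH rep (ltn0Sn m).
have [rr r1 rM] := rep.
pose Q : 'M[C]_(1 + m) := row_ebase v.
have Qu : Q \in unitmx by exact: row_ebase_unit.
(* The rank decomposition of the nonzero row [v] exhibits it as a multiple of the first row of
   [Q]. *)
have vQ : (row 0 Q :=: v)%MS.
  have := mulmx_ebase v; rewrite rank_rV v0 [col_ebase v]mx11_scalar.
  rewrite mul_scalar_mx -scalemxAl -/Q; set c := col_ebase v 0 0.
  rewrite (_ : pid_mx 1 = delta_mx 0 0); last first.
    by apply/matrixP => i j; rewrite !mxE !ord1 /= eq_sym andbT; case: j => -[].
  rewrite -rowE => E; rewrite -E; apply/eqmx_sym/eqmx_scale.
  by apply: contra_neq v0 => c0; rewrite -E c0 scale0r.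
pose rho1 x : 'M[C]_(1 + m) := Q *m rho x *m invmx Q.
(* The first basis vector spans a stable line, so the first row of [rho1 x] vanishes beyond its
   first entry. *)
have ur x : H x -> ursubmx (rho1 x) = 0.
  move=> Hx; have : stablemx (row 0 Q) (rho x).
    by rewrite (eqmxMr _ vQ) vQ stv.
  case/sub_rVP => a E; apply/matrixP => i j.
  have -> (A : 'M[C]_(1 + m)) : ursubmx A i j = row 0 A 0 (rshift 1 j).
    by rewrite !mxE; congr (A _ _); apply/val_inj; rewrite /= ord1.
  by rewrite !row_mul E -scalemxAl -row_mul mulmxV // !mxE mulr0.
pose rho2 x := drsubmx (rho1 x).
have rho1M x y : H x -> H y -> rho1 (x * y)%g = rho1 x *m rho1 y.
  by move=> Hx Hy; rewrite /rho1 rM // !mulmxA mulmxKV.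
have [|P2 P2u tP2] := IH rho2.
  split.
  - move=> i j; apply: (@regularG_ext _ _
      (fun x => rho1 x (rshift 1 i) (rshift 1 j))).
      apply: regular_mx_mul (regular_mx_cst _) _ _.
      exact: regular_mx_mul (regular_mx_cst _) rr.
    by move=> x; rewrite !mxE.
  - by rewrite /rho2 /rho1 r1 mulmx1 mulmxV // scalar_mx_block block_mxKdr.
  - move=> x y Hx Hy; rewrite /rho2 rho1M // -{1}[rho1 x]submxK -{1}[rho1 y]submxK.
    by rewrite mulmx_block block_mxKdr ur // mulmx0 add0r.
pose D : 'M[C]_(1 + m) := block_mx 1%:M 0 0 P2.
have Du : D \in unitmx by rewrite unitmxE det_lblock det1 mul1r -unitmxE.
exists (D *m Q); first by rewrite unitmx_mul Du.
move=> x Hx; have -> : invmx (D *m Q) = invmx Q *m invmx D.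
  exact: (@invrM _ (D : 'M_m.+1) Q).
have -> : D *m Q *m rho x *m (invmx Q *m invmx D) = D *m rho1 x *m invmx D.
  by rewrite /rho1 !mulmxA.
have -> : invmx D = block_mx 1%:M 0 0 (invmx P2).
  by rewrite invmx_block_diag ?invmx1.
rewrite -[rho1 x]submxK ur // !mulmx_block.
rewrite !(mulmx0, mul0mx, mul1mx, mulmx1, addr0, add0r).
have trig1 (A : 'M[C]_1) B : @is_trig_mx _ (1 + m) (1 + m)
    (block_mx A 0 B (P2 *m rho2 x *m invmx P2)).
  by rewrite is_trig_block_mx // eqxx mx11_is_trig tP2.
exact: trig1.
Qed.

End LieKolchin.

(** * Eigenvectors in the flag modules *)

(** The Cauchy-Binet expansion before terms are collected: [f] runs over all maps, injective or
    not. *)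
Lemma det_mulmx_rowsub (A : comNzRingType) k n (M : 'M[A]_(k, n)) (N : 'M[A]_(n, k)) :
  \det (M *m N) =
  \sum_(f : {ffun 'I_k -> 'I_n}) (\prod_i M i (f i)) * \det (rowsub f N).
Proof.
pose MN (s : {perm 'I_k}) i j := M i j * N j (s i).
transitivity (\sum_(f : {ffun 'I_k -> 'I_n})
    \sum_(s : 'S_k) (-1) ^+ s * \prod_i MN s i (f i)).
  rewrite exchange_big; apply: eq_bigr => /= s _; rewrite -big_distrr /=.
  congr (_ * _); rewrite -(bigA_distr_bigA (MN s)) /=.
  by apply: eq_bigr => x _; rewrite mxE.
apply: eq_bigr => f _; rewrite [X in _ * X]/determinant big_distrr /=.
apply: eq_bigr => s _; rewrite mulrCA -big_split /=; congr (_ * _).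
by apply: eq_bigr => i _; rewrite !mxE.
Qed.

Section Eigenvectors.
Variables (R : realType) (n : nat).
Local Notation C := R[i].
Local Notation G := (SL R n).

Definition minor_span k (F : 'M[C]_n -> C) := exists c : {set 'I_n} -> C,
  forall X, F X =
    \sum_(I : {set 'I_n} | #|I| == k) c I * minor X I (first_cols n #|I|).

Lemma minor_span_sum k (T : finType) (a : T -> C) (F : T -> 'M[C]_n -> C) :
  (forall t, minor_span k (F t)) -> minor_span k (fun X => \sum_t a t * F t X).
Proof.
move=> /choice[c hc]; exists (fun I => \sum_t a t * c t I) => X.
under eq_bigr do rewrite hc big_distrr /=.
rewrite exchange_big; apply: eq_bigr => I _; rewrite big_distrl /=.
by apply: eq_bigr => t _; rewrite mulrA.
Qed.

(** If [f] is not injective, two rows agree; otherwise the determinant is a flag minor up to the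
    sign of the permutation sorting the values of [f]. *)
Lemma minor_span_rowsub k (kn : (k <= n)%N) (f : 'I_k -> 'I_n) :
  minor_span k (fun X => \det (rowsub f (colsub (widen_ord kn) X))).
Proof.
have [/injectiveP injf|/injectivePn[a [b ab fab]]] := boolP (injectiveb f);
  last first.
  exists (fun=> 0) => X; rewrite big1 => [|I _]; last by rewrite mul0r.
  by apply: (determinant_alternate ab) => j; rewrite !mxE fab.
have [I fI] : exists I : {set 'I_n}, forall a, f a \in I.
  by exists [set: 'I_n]%SET => a; rewrite finset.in_setT.
have {I fI} [I [fI kI]] : exists I : {set 'I_n}, (forall a, f a \in I) /\ #|I| = k.
  exists (f @: 'I_k)%SET; split=> [a|]; first exact: imset_f.
  by rewrite card_imset // card_ord.
move: f kn injf fI; case: _ / kI => f kn injf fI.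
have rankK a : enum_val (enum_rank_in (fI a) (f a)) = f a by rewrite enum_rankK_in.
have injs : injective (fun a => enum_rank_in (fI a) (f a)).
  by move=> a b /(congr1 enum_val); rewrite !rankK => /injf.
pose s := perm injs.
exists (fun J => (-1) ^+ s *+ (J == I)) => X.
rewrite (bigD1 I) //= eqxx mulr1n big1 ?addr0; last first.
  by move=> J /andP[_ /negPf ->]; rewrite mulr0n mul0r.
rewrite (minor_first_cols _ kn) -det_perm -det_mulmx -row_permE.
by congr (\det _); apply/matrixP => a b; rewrite !mxE permE rankK.
Qed.

Lemma minor_span_det k (kn : (k <= n)%N) (M : 'M[C]_(k, n)) :
  minor_span k (fun X => \det (M *m colsub (widen_ord kn) X)).
Proof.
have [c hc] := minor_span_sum (fun f : {ffun 'I_k -> 'I_n} => \prod_i M i (f i))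
  (fun f : {ffun 'I_k -> 'I_n} => minor_span_rowsub kn f).
by exists c => X; rewrite -hc det_mulmx_rowsub.
Qed.

Definition topleft k (kn : (k <= n)%N) (X : 'M[C]_n) :=
  mxsub (widen_ord kn) (widen_ord kn) X.

(** The first k rows of the lower triangular [L] vanish beyond column k, so only the first k rows of
    [X] enter. *)
Lemma topleft_mul_trig k (kn : (k <= n)%N) (L X : 'M[C]_n) : is_trig_mx L ->
  topleft kn (L *m X) = topleft kn L *m topleft kn X.
Proof.
move=> /is_trig_mxP trL; apply/matrixP => a b.
rewrite !mxE (bigID (fun l : 'I_n => (l < k)%N)) /=.
rewrite (big_ord_narrow kn) [X in _ + X]big1 ?addr0; last first.
  by move=> l; rewrite -leqNgt => kl; rewrite trL ?mul0r //=; exact: leq_trans kl.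
by apply: eq_bigr => c _; rewrite !mxE.
Qed.

Lemma flag_module_topleft k (kn : (k <= n)%N) (P : 'M[C]_n) :
  exists2 f : coordGU R n, flag_module k f &
    forall x : G, f (\pi_(GmodU R n) x) = \det (topleft kn (P *m slval x)).
Proof.
have [c hc] := minor_span_det kn (rowsub (widen_ord kn) P).
pose f p := \sum_(I : {set 'I_n} | #|I| == k) c I * @flag_minor R n I p.
have fE (x : G) : f (\pi_(GmodU R n) x) = \det (topleft kn (P *m slval x)).
  rewrite /f; under eq_bigr do rewrite flag_minor_pi.
  rewrite -hc; congr (\det _); apply/matrixP => a b; rewrite !mxE.
  by apply: eq_bigr => l _; rewrite !mxE.
have rf : f \in @regularGU R n.
  apply/regularGUP; under eq_fun do rewrite fE.
  apply: regularG_det => a b.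
  apply: (@regularG_ext _ _
    (fun x => (P *m slval x) (widen_ord kn a) (widen_ord kn b))).
    exact: regular_mx_mul (regular_mx_cst _) (@regular_mx_slval R n) _ _.
  by move=> x; rewrite [RHS]mxE.
by exists (CoordGU rf) => //; exists c.
Qed.

Lemma topleft_unit k (kn : (k <= n)%N) (P : 'M[C]_n) :
  (0 < k)%N -> P \in unitmx ->
  exists x : G, \det (topleft kn (P *m slval x)) != 0.
Proof.
move=> k0 Pu; have dP : \det P != 0 by rewrite -unitfE -unitmxE.
pose i0 : 'I_n := widen_ord kn (Ordinal k0).
(* The entry [\det P] compensates the factor [invmx P], so that the witness has determinant 1. *)
pose d : 'rV[C]_n := \row_i (if i == i0 then \det P else 1).
have d0 i : d 0 i != 0 by rewrite mxE; case: ifP => // _; exact: oner_neq0.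
have detx : \det (invmx P *m diag_mx d) == 1.
  rewrite det_mulmx det_inv det_diag (bigD1 i0) //= mxE eqxx mulKf //.
  by rewrite big1 // => i /negPf i_i0; rewrite mxE i_i0.
exists (MkSL detx); rewrite /= mulKVmx //.
have -> : topleft kn (diag_mx d) = diag_mx (colsub (widen_ord kn) d).
  by apply/matrixP => a b; rewrite !mxE -(inj_eq val_inj).
by rewrite det_diag; apply/prodf_neq0 => a _; rewrite mxE.
Qed.

(** In the basis [P] given by Lie-Kolchin, P b^-1 x is a lower triangular matrix times P x, so the
    leading minor of P x is multiplied by a scalar. The inverse comes from the action on
    functions. *)
Lemma exists_eigenvector (B : set G) k : connected_solvable_closed B ->
  (0 < k <= n)%N -> exists2 f : coordGU R n, flag_module k f & eigenvector B f.
Proof.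
move=> [sB _ conB [l solB]] /andP[k0 kn].
have [|P Pu trP] := lie_kolchin sB conB solB (rho := fun x : G => slval x).
  by split=> //; exact: regular_mx_slval.
have [f ff fE] := flag_module_topleft kn P; exists f => //; split.
  have [x] := topleft_unit kn k0 Pu; apply: contra_neq => f0.
  by rewrite -fE f0.
move=> b Bb; have Bb' : B b^-1%g by case: sB => _ _; exact.
exists (\det (topleft kn (P *m slval b^-1%g *m invmx P))).
apply: coordGU_ext => x.
rewrite [LHS]/= actGU_pi fE slvalM.
rewrite -[X in _ = X]/(_ * f (\pi_(GmodU R n) x)) fE -det_mulmx.
rewrite -topleft_mul_trig; last exact: trP.
by rewrite -!mulmxA mulKmx.
Qed.

End Eigenvectors.

(** * Invariant valuations from one-parameter subgroups *)

Lemma prod_exprz (F : fieldType) (s : F) (I : Type) (r : seq I) (P : pred I)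
    (k : I -> int) :
  s != 0 -> \prod_(i <- r | P i) s ^ k i = s ^ (\sum_(i <- r | P i) k i).
Proof.
by move=> s0; apply/esym/big_morph => [a b|//]; exact: expfzDr.
Qed.

Section Order.
Variables (R : realType) (n : nat).
Local Notation C := R[i].
Local Notation G := (SL R n).
Local Notation coordGU := (coordGU R n).
Local Notation pi := (\pi_(GmodU R n)).
Variable h : 'I_n -> int.
Hypothesis sum_h : \sum_i h i = 0.

(* Its value at s = 0 is the irrelevant default 1. *)
Definition cochar (s : C) : G := insubd (1%g : G) (diag_mx (\row_i s ^ h i)).

Lemma slval_cochar s : s != 0 -> slval (cochar s) = diag_mx (\row_i s ^ h i).
Proof.
move=> s0; rewrite /cochar insubdK // unfold_in /= det_diag.
under eq_bigr do rewrite mxE.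
by rewrite prod_exprz // sum_h.
Qed.

Lemma mul_cochar x s i j : s != 0 ->
  slval (x * cochar s)%g i j = slval x i j * s ^ h j.
Proof. by move=> s0; rewrite slvalM slval_cochar // mul_mx_diag !mxE. Qed.

Lemma cochar1 : cochar 1 = 1%g.
Proof.
apply/val_inj; rewrite /= slval_cochar ?oner_neq0 //.
by apply/matrixP => i j; rewrite !mxE exp1rz.
Qed.

(* f (x . cochar s) = s ^ k * (r x).[s], and r x does not vanish identically in
   x at s = 0: k is the order at s = 0 of f along the right translates by the
   one-parameter subgroup cochar. *)
Definition has_order (f : G -> C) (k : int) := exists r : G -> {poly C},
  [/\ forall l, regularG (fun x => (r x)`_l), exists x, (r x)`_0 != 0 &
      forall x s, s != 0 -> f (x * cochar s)%g = s ^ k * (r x).[s]].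

Lemma poly_eq_horner (p q : {poly C}) :
  (forall s, s != 0 -> p.[s] = q.[s]) -> p = q.
Proof.
move=> pq; apply/subr0_eq/(mulfI (negbT (polyX_eq0 C))); rewrite mulr0.
apply: poly_eq0_horner => s; rewrite !hornerE.
by have [->|/pq ->] := eqVneq s 0; rewrite ?mul0r // subrr mulr0.
Qed.

(** At a point x where [r x] has nonzero constant term, l > k would force ['X] to divide [r x].
    Uniqueness of the order and the ultrametric inequality both follow from this bound. *)
Lemma has_order_ge f k l (q : G -> {poly C}) : has_order f k ->
  (forall x s, s != 0 -> f (x * cochar s)%g = s ^ l * (q x).[s]) -> l <= k.
Proof.
move=> [r [_ [x rx0] hr]] hq; rewrite leNgt; apply/negP => kl.
have [d dE] : exists d : nat, l - k = d.+1%:Z.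
  exists `|(l - k)%R|%N.-1; rewrite prednK ?absz_gt0 ?subr_eq0 ?gt_eqF //.
  by rewrite gez0_abs // subr_ge0 ltW.
suff E : r x = 'X^(d.+1) * q x by move: rx0; rewrite E coefXnM eqxx.
apply: poly_eq_horner => s s0; apply: (mulfI (expfz_neq0 k s0)).
rewrite -hr // hq // hornerM hornerXn mulrA; congr (_ * _).
by rewrite -[s ^+ _]/(s ^ d.+1%:Z) -dE -expfzDr // addrC subrK.
Qed.

Lemma has_order_uniq f k l : has_order f k -> has_order f l -> k = l.
Proof.
move=> hk hl; apply/eqP; rewrite eq_le.
have [r [_ _ hr]] := hk; have [q [_ _ hq]] := hl.
by rewrite (has_order_ge hl hr) (has_order_ge hk hq).
Qed.

(** The constant terms are nonzero regular functions on [G], and C[G] is an integral domain, so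
    their product is nonzero somewhere. This is where the regularity of coefficients in [has_order]
    is used. *)
Lemma has_orderM f g k l : has_order f k -> has_order g l ->
  has_order (fun x => f x * g x) (k + l).
Proof.
move=> [r [rr [x rx] hr]] [q [rq [y qy] hq]].
exists (fun x => r x * q x); split.
- move=> m; apply: (@regularG_ext _ _
    (fun x => \sum_(i < m.+1) (r x)`_i * (q x)`_(m - i))).
    by apply: regularG_sum => i _; exact: regularG_mul.
  by move=> z; rewrite coefM.
- apply: contrapT => /forallNP z0.
  have [z||] := regularG_integral (rr 0%N) (rq 0%N).
  + by have /negP := z0 z; rewrite negbK coef0M => /eqP.
  + by move=> /(_ x) /eqP; exact/negP.
  + by move=> /(_ y) /eqP; exact/negP.
- by move=> z s s0; rewrite hr // hq // hornerM expfzDr // mulrACA.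
Qed.

(** Once s^min(k, l) is factored out, the sum is still polynomial in s, and [has_order_ge]
    applies. *)
Lemma has_orderD f g k l m : has_order f k -> has_order g l ->
  has_order (fun x => f x + g x) m -> Num.min k l <= m.
Proof.
move=> [r [_ _ hr]] [q [_ _ hq]] fg; set d := Num.min k l.
have lift (a : int) (p : {poly C}) s : d <= a -> s != 0 ->
    s ^ a * p.[s] = s ^ d * ('X^`|a - d|%N * p).[s].
  move=> da s0; rewrite hornerM hornerXn mulrA; congr (_ * _).
  by rewrite -[s ^+ _]/(s ^ `|a - d|%N%:Z) gez0_abs ?subr_ge0 // -expfzDr // subrKC.
apply: (has_order_ge (q := fun x =>
  'X^`|k - d|%N * r x + 'X^`|l - d|%N * q x) fg) => x s s0.
by rewrite hr // hq // hornerD mulrDr -!lift // /d ge_min lexx ?orbT.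
Qed.

(** Left translations commute with right multiplication by [cochar s]; this is the source of
    G-invariance. *)
Lemma has_order_translate f g k :
  has_order f k -> has_order (fun x => f (g * x)%g) k.
Proof.
move=> [r [rr [x rx] hr]]; exists (fun x => r (g * x)%g); split.
- by move=> l; exact: (regularG_translate g (rr l)).
- by exists (g^-1 * x)%g; rewrite mulKVg.
- by move=> y s s0; rewrite mulgA hr.
Qed.

Lemma has_order_homogeneous f k : regularG f -> (exists x, f x != 0) ->
  (forall x s, s != 0 -> f (x * cochar s)%g = s ^ k * f x) -> has_order f k.
Proof.
move=> rf [x fx] hf; exists (fun x => (f x)%:P); split.
- move=> l; apply: (@regularG_ext _ _ (fun x => (l == 0)%:R * f x)).
    exact: regularG_scale.
  by move=> y; rewrite coefC; case: eqP => _; rewrite ?mul1r ?mul0r.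
- by exists x; rewrite coefC eqxx.
- by move=> y s s0; rewrite hornerC hf.
Qed.

(** Along the one-parameter subgroup f is a Laurent polynomial in s with coefficients regular in x;
    one power s^N clears the denominators for all x. *)
Lemma laurent_cochar f : regularG f -> exists (N : nat) (r : G -> {poly C}),
  (forall l, regularG (fun x => (r x)`_l)) /\
  (forall x s, s != 0 -> s ^+ N * f (x * cochar s)%g = (r x).[s]).
Proof.
elim=> [c|i j|{}f g _ [N [r [rr hr]]] _ [M [q [rq hq]]]
              |{}f g _ [N [r [rr hr]]] _ [M [q [rq hq]]]].
- exists 0%N, (fun=> c%:P); split=> [l|x s s0]; first exact: regularG_cst.
  by rewrite mul1r hornerC.
(* Column j is scaled by s^(h j); the shift by |h j| makes the exponent a natural number. *)
- pose m := absz (h j + (absz (h j))%:Z).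
  have mE : m%:Z = h j + (absz (h j))%:Z.
    by rewrite /m gez0_abs // abszE -lerBlDr sub0r lerNl -normrN ler_norm.
  exists (absz (h j)), (fun x : G => (slval x i j)%:P * 'X^m).
  split=> [l|x s s0].
    apply: (@regularG_ext _ _ (fun x => slval x i j * ('X^m : {poly C})`_l)).
      exact/regularG_mul/regularG_cst/regularG_entry.
    by move=> x; rewrite coefCM.
  rewrite mul_cochar // hornerM hornerC hornerXn mulrCA; congr (_ * _).
  by rewrite -2![s ^+ _]/(s ^ _%:Z) -expfzDr // mE addrC.
- exists (N + M)%N, (fun x => 'X^M * r x + 'X^N * q x); split=> [l|x s s0].
    apply: (@regularG_ext _ _ (fun x => (if (l < M)%N then 0 else (r x)`_(l - M))
      + (if (l < N)%N then 0 else (q x)`_(l - N)))).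
      by apply: regularG_add; case: ltnP => _ //; exact: regularG_cst.
    by move=> x; rewrite coefD !coefXnM.
  by rewrite hornerD !hornerM !hornerXn -hr // -hq // mulrDr exprD !mulrA
    [s ^+ M * _]mulrC.
- exists (N + M)%N, (fun x => r x * q x); split=> [l|x s s0].
    apply: (@regularG_ext _ _ (fun x => \sum_(i < l.+1) (r x)`_i * (q x)`_(l - i))).
      by apply: regularG_sum => i _; exact: regularG_mul.
    by move=> x; rewrite coefM.
  by rewrite hornerM -hr // -hq // exprD mulrACA.
Qed.

Lemma has_order_exists f : regularG f -> (exists x, f x != 0) ->
  exists k, has_order f k.
Proof.
move=> /laurent_cochar[N [r [rr hr]]] [x fx].
have ex0 : exists l, `[< exists x, (r x)`_l != 0 >].
  have : r x != 0.
    apply: contra_neq fx => rx0; have := hr x 1 (oner_neq0 _).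
    by rewrite rx0 horner0 expr1n mul1r cochar1 mulg1.
  rewrite -lead_coef_eq0 => rx0; exists (size (r x)).-1.
  by apply/asboolP; exists x.
(* Let l be the least index whose coefficient is not identically zero in x: ['X^l] then divides
   every [r z], and the order is l - N. *)
case: (ex_minnP ex0) => l /asboolP[y ry] lmin.
have rE z : r z = drop_poly l (r z) * 'X^l.
  rewrite -[LHS](poly_take_drop l) [take_poly _ _](_ : _ = 0) ?add0r //.
  apply/polyP => i; rewrite coef_take_poly coef0; case: ltnP => // il.
  apply/eqP; apply: contraTT il => rzi; rewrite -leqNgt; apply: lmin.
  by apply/asboolP; exists z.
exists (l%:Z - N%:Z), (fun x => drop_poly l (r x)); split.
- by move=> i; under eq_fun do rewrite coef_drop_poly; exact: rr.
- by exists y; rewrite coef_drop_poly add0n.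
- move=> z s s0; apply: (mulfI (expf_neq0 N s0)); rewrite hr // {1}rE.
  rewrite hornerM hornerXn mulrA -2![s ^+ _]/(s ^ _%:Z) -expfzDr //.
  by rewrite addrC subrK mulrC.
Qed.

(** * The order on C[G/U] and on its fraction field *)

Lemma coordGU_neq0 (f : coordGU) : f != 0 -> exists x : G, f (pi x) != 0.
Proof.
move=> f0; apply: contrapT => /forallNP z; move/eqP: f0; apply.
by apply: coordGU_ext => x; have /negP := z x; rewrite negbK => /eqP.
Qed.

(** The default 0 is taken exactly at f = 0, which has no order. *)
Definition order (f : coordGU) : int :=
  xget 0 [set k | has_order (fun x => f (pi x)) k].

Lemma has_order_order (f : coordGU) :
  f != 0 -> has_order (fun x => f (pi x)) (order f).
Proof.
move=> f0; have [||k hk] := @has_order_exists (fun x => f (pi x)).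
- exact: coordGU_regular.
- exact: coordGU_neq0.
- exact: (@xgetI _ 0 [set k | has_order (fun x => f (pi x)) k] k hk).
Qed.

Lemma order_eq (f : coordGU) k : has_order (fun x => f (pi x)) k -> order f = k.
Proof.
by move=> hk; apply: (has_order_uniq _ hk);
  exact: (@xgetI _ 0 [set k | has_order (fun x => f (pi x)) k] k hk).
Qed.

Lemma orderM (f g : coordGU) :
  f != 0 -> g != 0 -> order (f * g) = order f + order g.
Proof.
by move=> f0 g0; apply: order_eq; apply: has_orderM; exact: has_order_order.
Qed.

Lemma orderD (f g : coordGU) : f != 0 -> g != 0 -> f + g != 0 ->
  Num.min (order f) (order g) <= order (f + g).
Proof.
move=> /has_order_order f0 /has_order_order g0 /has_order_order.
exact: has_orderD.
Qed.

Lemma order_act (g : G) (f : coordGU) : f != 0 -> order (act_coord g f) = order f.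
Proof.
move=> f0; apply: order_eq.
rewrite (_ : (fun x => _) = fun x => f (pi (g^-1 * x)%g)).
  exact: (has_order_translate g^-1%g (has_order_order f0)).
by apply/funext => x; rewrite /= actGU_pi.
Qed.

Lemma order_cst (c : C) : c != 0 -> order (cstGU n c) = 0.
Proof.
move=> c0; apply/order_eq/has_order_homogeneous.
- exact: coordGU_regular.
- by exists 1%g.
- by move=> x s s0; rewrite expr0z mul1r.
Qed.

Lemma flag_minor_cochar (I : {set 'I_n}) x s : s != 0 ->
  flag_minor I (pi (x * cochar s)%g) =
  s ^ (\sum_(j < n | (j < #|I|)%N) h j) * flag_minor I (pi x).
Proof.
move=> s0; have kn : (#|I| <= n)%N by rewrite -[X in (_ <= X)%N]card_ord max_card.
rewrite !flag_minor_pi !(minor_first_cols _ kn) (big_ord_narrow kn) mulrC.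
rewrite -prod_exprz //.
pose d : 'rV[C]_#|I| := \row_a s ^ h (widen_ord kn a).
rewrite (_ : \prod_i _ = \det (diag_mx d)); last first.
  by rewrite det_diag; apply: eq_bigr => a _; rewrite mxE.
rewrite -det_mulmx; congr (\det _); apply/matrixP => a b.
by rewrite mul_mx_diag [LHS]mxE mul_cochar // !mxE.
Qed.

(** All k x k flag minors scale by the same power of s, hence so does every combination of them; the
    value is therefore the same for any choice of eigenvector. *)
Lemma order_flag_module k (f : coordGU) : flag_module k f -> f != 0 ->
  order f = \sum_(j < n | (j < k)%N) h j.
Proof.
move=> [c fE] f0; apply/order_eq/has_order_homogeneous.
- exact: coordGU_regular.
- exact: coordGU_neq0.
- move=> x s s0; rewrite !fE big_distrr /=; apply: eq_bigr => I /eqP kI.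
  by rewrite flag_minor_cochar // kI mulrCA.
Qed.

Local Notation tofrac := (@FracField.tofrac coordGU).

Definition order_val (q : rat) (f : ratGU R n) : rat :=
  (order \n_(repr f) - order \d_(repr f))%:~R * q.

(** Cross-multiplying two fractions for the same function and using [orderM] shows that the value
    does not depend on the representative. *)
Lemma order_val_div q (a b : coordGU) : a != 0 -> b != 0 ->
  order_val q (tofrac a / tofrac b) = (order a - order b)%:~R * q.
Proof.
move=> a0 b0; rewrite /order_val; set f := _ / _.
have f0 : f != 0 by rewrite mulf_neq0 ?invr_eq0 ?tofrac_eq0.
have d0 : \d_(repr f) != 0 by exact: denom_ratioP.
have fE := frac_numden f.
have n0 : \n_(repr f) != 0.
  by apply: contra_neq f0 => n0; rewrite fE n0 tofrac0 mul0r.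
move/eqP: fE; rewrite {1}/f eqr_div ?tofrac_eq0 // -!tofracM tofrac_eq => /eqP E.
congr (_%:~R * _); apply/eqP; rewrite subr_eq addrAC eq_sym subr_eq.
by rewrite -!orderM // E.
Qed.

Lemma order_val_tofrac q (a : coordGU) :
  a != 0 -> order_val q (tofrac a) = (order a)%:~R * q.
Proof.
move=> a0; rewrite -[tofrac a]divr1 -tofrac1 order_val_div ?oner_neq0 //.
rewrite (_ : 1 = cstGU n 1) ?order_cst ?oner_neq0 ?subr0 //; exact/val_inj.
Qed.

Lemma order_val_invariant q : 0 < q -> invariant_valuation (order_val q).
Proof.
move=> q0; have frac f : f != 0 ->
    exists a b, [/\ a != 0, b != 0 & f = tofrac a / tofrac b].
  move=> f0; exists \n_(repr f), \d_(repr f); split; last exact: frac_numden.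
    by apply: contra_neq f0 => n0; rewrite (frac_numden f) n0 tofrac0 mul0r.
  exact: denom_ratioP.
split; first split.
- move=> _ _ /frac[a [b [a0 b0 ->]]] /frac[c [d [c0 d0 ->]]].
  rewrite mulf_div -!tofracM !order_val_div ?mulf_neq0 // !orderM //.
  by rewrite -mulrDl -intrD opprD addrACA.
- move=> _ _ /frac[a [b [a0 b0 ->]]] /frac[c [d [c0 d0 ->]]].
  have b0' : tofrac b != 0 by rewrite tofrac_eq0.
  have d0' : tofrac d != 0 by rewrite tofrac_eq0.
  (* Over a common denominator the inequality reduces to [orderD] for the numerators. *)
  have E : tofrac a / tofrac b + tofrac c / tofrac d =
      tofrac (a * d + c * b) / tofrac (b * d).
    by rewrite (addf_div _ _ b0' d0') tofracD !tofracM.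
  rewrite E => s0.
  have {}s0 : a * d + c * b != 0.
    by apply: contra_neq s0 => ->; rewrite tofrac0 mul0r.
  rewrite !order_val_div ?mulf_neq0 // orderM // ge_min !ler_pM2r //.
  have := orderD (mulf_neq0 a0 d0) (mulf_neq0 c0 b0) s0; rewrite !orderM //.
  by rewrite ge_min !ler_int !lerBrDr addrA subrK [order b + _]addrC addrA subrK.
- by exists q => f f0; exists (order \n_(repr f) - order \d_(repr f)).
- move=> c c0; rewrite order_val_tofrac ?order_cst ?mul0r //.
  by apply: contra_neq c0 => /(congr1 (fun k : coordGU => k (pi 1%g))).
- move=> g _ /frac[a [b [a0 b0 ->]]].
  have act0 k : k != 0 -> act_coord g k != 0 by apply: contra_neq => /act_coord_eq0.
  by rewrite act_ratE // !order_val_div ?act0 // !order_act.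
Qed.

End Order.

(** * The spherical logarithm and the valuation cone *)

Section Increments.
Variables (V : zmodType) (n : nat) (y : 'I_n.-1 -> V).

(* The sequence 0, y_0, ..., y_(n-2), 0: the successive differences of its terms
   are n elements with sum 0 and partial sums y_0, ..., y_(n-2). *)
Definition padded (k : nat) : V :=
  if k is j.+1 then (if insub j is Some i then y i else 0) else 0.

Lemma paddedS (i : 'I_n.-1) : padded i.+1 = y i.
Proof. by rewrite /padded valK. Qed.

Lemma padded_last : padded n = 0.
Proof.
suff : forall k, k = n -> padded k = 0 by exact.
by case=> // j jn; rewrite /padded insubN // -leqNgt -jn.
Qed.

Definition increment (k : nat) : V := padded k.+1 - padded k.

Lemma sum_increment k : \sum_(j < k) increment j = padded k.
Proof. by rewrite -(big_mkord predT increment) telescope_sumr ?subr0. Qed.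

End Increments.

(** * Surjectivity of the spherical logarithm *)

Section SphericalLogarithm.
Variables (R : realType) (n : nat).
Local Notation C := R[i].
Local Notation G := (SL R n).
Local Notation pi := (\pi_(GmodU R n)).

Lemma card_first_cols k : (k <= n)%N -> #|first_cols n k| = k.
Proof.
move=> kn; rewrite -sum1_card.
under eq_bigl do rewrite finset.in_set.
by rewrite (big_ord_narrow kn) sum1_card card_ord.
Qed.

Lemma minor_diag (d : 'rV[C]_n) (I : {set 'I_n}) :
  minor (diag_mx d) I (first_cols n #|I|) =
  if I == first_cols n #|I| then \prod_(j < n | (j < #|I|)%N) d 0 j else 0.
Proof.
have kn : (#|I| <= n)%N by rewrite -[X in (_ <= X)%N]card_ord max_card.
case: eqP => [IE|/eqP IE].
  rewrite (big_ord_narrow kn) /minor -IE.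
  have -> : (\matrix_(a < #|I|, b < #|I|)
      diag_mx d (enum_val a) (nth (enum_val a) (enum I) b)) =
      diag_mx (\row_a d 0 (enum_val a)).
    apply/matrixP => a b; rewrite !mxE (set_nth_default (enum_default b)) -?cardE //.
    by rewrite -/(enum_val b) (inj_eq enum_val_inj).
  rewrite det_diag; under eq_bigr do rewrite mxE.
  rewrite -(big_ord_narrow kn) -(big_enum_val (fun j => d 0 j)).
  by apply: eq_bigl => j; rewrite [in LHS]IE finset.in_set.
(* A set other than the initial segment of its size contains an index beyond that segment, and the
   corresponding row of the minor is zero. *)
have [a aI] : exists a : 'I_#|I|, (#|I| <= enum_val a)%N.
  apply: contrapT => /forallNP small; move/eqP: IE; apply.
  apply/eqP; rewrite eqEcard card_first_cols // leqnn andbT.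
  apply/fintype.subsetP => j jI; rewrite finset.in_set.
  by have /negP := small (enum_rank_in jI j); rewrite -ltnNge enum_rankK_in.
rewrite (minor_first_cols _ kn) /determinant big1 // => s _.
rewrite (bigD1 a) //= !mxE; case: eqP => [/(congr1 val) /= E|_].
  by move: aI; rewrite E leqNgt ltn_ord.
by rewrite mulr0n mul0r mulr0.
Qed.

Lemma phi_diag (e : 'I_n -> R) (x : G) (i : 'I_n.-1) :
  slval x = diag_mx (\row_j (expR (e j))%:C) ->
  phi i (pi x) = expR (\sum_(j < n | (j < i.+1)%N) e j) ^+ 2.
Proof.
move=> xE; have i_n := leq_trans (ltn_ord i) (leq_pred n).
have cI := card_first_cols i_n.
rewrite /phi (bigD1 (first_cols n i.+1)) /= ?cI //.
rewrite flag_minor_pi xE minor_diag cI eqxx [X in _ + X]big1 ?addr0; last first.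
  move=> I /andP[/eqP kI /negPf I_ne].
  rewrite flag_minor_pi xE minor_diag kI I_ne.
  by rewrite /= expr0n addr0 sqrtr0 expr0n.
rewrite (eq_bigr (fun j => (expR (e j))%:C)) => [|j _]; last by rewrite mxE.
rewrite -(rmorph_prod (real_complex R)) -expR_sum.
by rewrite /= expr0n addr0 sqr_sqrtr // sqr_ge0.
Qed.

Lemma sLog_surjective (t : R) : 0 < t -> t != 1 ->
  range (@sLog R n t) = [set: 'rV[R]_n.-1].
Proof.
move=> t0 t1; apply/seteqP; split=> // y _.
have lnt : ln t != 0 by rewrite ln_eq0.
(* The factor 1/2 undoes the square in [phi], and [ln t] undoes the base of the logarithm. The
   increments sum to 0, which gives determinant 1. *)
pose e := @increment R n (fun i => y 0 i * ln t / 2).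
have detx : \det (diag_mx (\row_(j < n) (expR (e j))%:C) : 'M[C]_n) == 1.
  rewrite det_diag; under eq_bigr do rewrite mxE.
  rewrite -(rmorph_prod (real_complex R)) -expR_sum sum_increment padded_last.
  by rewrite expR0.
exists (pi (MkSL detx)) => //; apply/rowP => i; rewrite mxE.
rewrite (@phi_diag (fun j => e j)) // /logt lnXn ?expR_gt0 // expRK.
have i_n := leq_trans (ltn_ord i) (leq_pred n).
rewrite (big_ord_narrow i_n) /= sum_increment paddedS.
by rewrite -[_ *+ 2]mulr_natr mulfVK ?pnatr_eq0 // mulfK.
Qed.

End SphericalLogarithm.

(** * The valuation cone is the whole space *)

Section ValuationCone.
Variables (R : realType) (n : nat).

Lemma valuation_cone_full (B : set (SL R n)) :
  connected_solvable_closed B -> valuation_cone B = setT.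
Proof.
move=> hB; apply/seteqP; split=> // a _.
pose den := \prod_j denq (a 0 j).
have den0 : 0 < den by apply: prodr_gt0 => j _; exact: denq_gt0.
pose z i := numq (a 0 i) * \prod_(j | j != i) denq (a 0 j).
have zE i : (z i)%:~R * (den%:~R)^-1 = a 0 i :> rat.
  have denE : den = denq (a 0 i) * \prod_(j | j != i) denq (a 0 j).
    by rewrite /den (bigD1 i).
  rewrite /z denE !intrM invfM mulrACA mulfV ?mulr1 ?divq_num_den //.
  by rewrite intr_eq0; apply/prodf_neq0 => j _; exact: denq_neq0.
have i_n (i : 'I_n.-1) := leq_trans (ltn_ord i) (leq_pred n).
(* The partial sums of [h] are the integers [z i], the coordinates of [a] times the common
   denominator [den]; the factor 1/den in the valuation recovers [a]. *)
pose h (j : 'I_n) := increment z j.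
have sum_h : \sum_j h j = 0 by rewrite sum_increment padded_last.
have /choice[f hf] (i : 'I_n.-1) : exists f, flag_module i.+1 f /\ eigenvector B f.
  by have [|f ? ?] := exists_eigenvector hB (k := i.+1); [rewrite i_n | exists f].
exists (order_val h (den%:~R)^-1); split.
  by apply: order_val_invariant => //; rewrite invr_gt0 ltr0z.
exists f => i; have [ff ef] := hf i; split=> //.
rewrite order_val_tofrac //; last by case: ef.
rewrite (order_flag_module sum_h ff) ?(big_ord_narrow (i_n i)) //; last by case: ef.
by rewrite sum_increment paddedS zE.
Qed.

Lemma dense_rat_rV m :
  closure [set map_mx (@ratr R) a | a in [set: 'rV[rat]_m]] = [set: 'rV[R]_m].
Proof.
apply/seteqP; split=> // y _ A [P hP sPA].
(* The neighbourhood contains a box, and each side of the box contains a rational. *)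
have /choice[a ha] j : exists q : rat, P 0 j (ratr q).
  have [||r [Pr [q _ qr]]] := @dense_rat R (interior (P 0 j)).
  - by exists (y 0 j); exact: hP.
  - exact: open_interior.
  - by exists q; rewrite qr; exact: interior_subset Pr.
exists (map_mx ratr (\row_j a j)); split; first by exists (\row_j a j).
by apply: sPA => i j; rewrite !mxE ord1.
Qed.

End ValuationCone.

Theorem mainTheorem7 (R : realType) (n : nat) (n_gt0 : (0 < n)%N)
    (t : R) (t_gt0 : 0 < t) (t_neq1 : t != 1)
    (B : set (SL R n)) (borelB : is_borel B) :
  range (@sLog R n t) = [set: 'rV[R]_n.-1] /\
  range (@sLog R n t) = real_valuation_cone B.
Proof.
rewrite sLog_surjective //; split=> //.
by rewrite /real_valuation_cone (valuation_cone_full borelB.1) dense_rat_rV.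
Qed.
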